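(* In the setting and with the notation of the context, the following variational formulas hold for $\lambda_0=\inf\{D(f):\ f\in\mathscr K,\ \|f\|=1\}$. (1) Difference form: $\displaystyle\inf_{v\in\widetilde{\mathscr V}_1}\sup_{i\in E}R_i(v)=\lambda_0=\sup_{v\in\mathscr V_1}\inf_{i\in E}R_i(v).$ (2) Single summation form: $\displaystyle\inf_{f\in\widetilde{\mathscr F}_I}\sup_{i\in E}I_i(f)^{-1}=\lambda_0=\sup_{f\in\mathscr F_I}\inf_{i\in E}I_i(f)^{-1}.$ (3) Double summation form: $\displaystyle\inf_{f\in\widetilde{\mathscr F}_{II}}\ \sup_{i\in\mathrm{supp}(f)}II_i(f)^{-1}=\lambda_0=\sup_{f\in\mathscr F_{II}}\inf_{i\in E}II_i(f)^{-1}.$ Moreover, the supremum on the right-hand side of each of the three formulas is attained.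
   Context: Setting. Fix $1\le N\le\infty$ and $E=\{k\in\mathbb Z:0\le k<N+1\}$. Birth rates $b_i>0$ for all $i\in E$ (in particular $b_N>0$ if $N<\infty$), death rates $a_i>0$ for $1\le i\in E$, $a_0=0$. $\mu_0=1$, $\mu_n=\frac{b_0\cdots b_{n-1}}{a_1\cdots a_n}$; $\nu_i=\frac1{\mu_ib_i}$. $\|\cdot\|$ is the norm of $L^2(\mu)$; $\mathscr K$ is the set of finitely supported functions on $E$; $D(f)=\sum_{i\in E}\mu_ib_i(f_{i+1}-f_i)^2$ with $f_{N+1}:=0$ if $N<\infty$ (Dirichlet boundary at $N+1$). Operators (conventions $1/0=\infty$, $1/\infty=0$): - $I_i(f)=\frac1{\mu_ib_i(f_i-f_{i+1})}\sum_{j\le i}\mu_jf_j$, with $f_{N+1}:=0$ if $N<\infty$. - $II_i(f)=\frac1{f_i}\sum_{j\in\mathrm{supp}(f),\,j\ge i}\frac1{\mu_jb_j}\sum_{k\le j}\mu_kf_k$ for $i\in\mathrm{supp}(f)$ (so for $f>0$ on $E$ the outer sum runs over $i\le j<N+1$). - $R_i(v)=a_i(1-v_{i-1}^{-1})+b_i(1-v_i)$, $i\in E$, where $v_{-1}>0$ is free (irrelevant since $a_0=0$) and $v_N:=0$ if $N<\infty$. Sets: - $\mathscr F_{II}=\{f:f>0\text{ on }E\}$; $\mathscr F_I=\{f:f>0\text{ on }E\text{ and strictly decreasing}\}$. - $\mathscr V_1=\{v=(v_i)_{0\le i<N}:\ v_i\in(0,1)\ \forall i\ \text{if }\sum_{j\in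 E}\nu_j<\infty;\ v_i\in(0,1]\ \forall i\ \text{if }\sum_{j\in E}\nu_j=\infty\}$. - $\widetilde{\mathscr F}_{II}=\{f:\ \text{there is } m \text{ with }1\le m<N+1,\ f_i>0\text{ for }i\le m,\ f_i=0\text{ for }i>m\}$. - $\widetilde{\mathscr F}_I=\{f:\ \text{there are }0\le n<m<N+1\text{ such that }f_i=f_n\text{ for }i\le n,\ f\text{ is strictly decreasing on }[n,m],\ f_m>0,\ f_i=0\text{ for }i>m\}$. - $\widetilde{\mathscr V}_1=\bigcup_{1\le m<N+1}\{v:\ \frac{a_{i+1}}{a_{i+1}+b_{i+1}}<v_i<1-\frac{a_i(v_{i-1}^{-1}-1)}{b_i}\text{ for }i=0,\dots,m-1,\ v_i=0\text{ for }i\ge m\}$. For such $v$, $R_i(v)=-\infty$ for $i>m$ (by $1/0=\infty$). *)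

(* Defs.v *)
From HB Require Import structures.
From mathcomp Require Import all_boot all_order all_algebra.
From mathcomp Require Import all_classical all_reals all_analysis.

Set Implicit Arguments.
Unset Strict Implicit.
Unset Printing Implicit Defensive.

Import Order.TTheory GRing.Theory Num.Theory.
Local Open Scope classical_set_scope.
Local Open Scope ring_scope.

(* [Some n] stands for the finite bound n, [None] for the bound +oo. *)
Definition ltN (k : nat) (N : option nat) : bool :=
  if N is Some n then (k < n)%N else true.

Definition leN (k : nat) (N : option nat) : bool :=
  if N is Some n then (k < n.+1)%N else true.

Definition E (N : option nat) : set nat := [set k | leN k N].

(* Functions on E (and sequences (v_i)_{0 <= i < N}) are represented by
   functions on nat whose values outside the index set are never used:
   [extE] and [extV] replace those values by 0. This implements the conventions
   f_{N+1} := 0 and v_N := 0 for N finite. *)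
Section Setting.
Variables (R : realType) (a b : nat -> R) (N : option nat).
Implicit Types (f v : nat -> R) (i : nat).

Definition extE f i : R := if leN i N then f i else 0.
Definition extV v i : R := if ltN i N then v i else 0.

Definition rates : Prop :=
  [/\ a 0%N = 0,
      forall i, E N i -> (1 <= i)%N -> 0 < a i &
      forall i, E N i -> 0 < b i].

Definition mu i : R := (\prod_(k < i) b k) / (\prod_(k < i) a k.+1).

Definition nu i : R := (mu i * b i)^-1.

Definition supp f : set nat := [set i | E N i /\ f i != 0].

Definition normL2 f : \bar R :=
  sqrte (\esum_(i in E N) (mu i * f i ^+ 2)%:E).

Definition K : set (nat -> R) := [set f | finite_set (supp f)].

Definition D f : \bar R :=
  \esum_(i in E N) (mu i * b i * (extE f i.+1 - extE f i) ^+ 2)%:E.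

Definition lambda0 : \bar R :=
  ereal_inf (D @` [set f | K f /\ normL2 f = 1%E]).

(* The inverse on \bar R satisfies 0^-1 = +oo and +oo^-1 = 0. *)
Definition opI f i : \bar R :=
  ((mu i * b i * (extE f i - extE f i.+1))%:E^-1
    * (\sum_(j < i.+1) mu j * f j)%:E)%E.

Definition opII f i : \bar R :=
  ((f i)%:E^-1
    * \esum_(j in supp f `&` [set j | (i <= j)%N])
        (nu j * \sum_(k < j.+1) mu k * f k)%:E)%E.

(* [shiftV v i] is v_{i-1}; the free value v_{-1} > 0, which is always
   multiplied by a_0 = 0, is taken to be 1. *)
Definition shiftV v i : R := if i is j.+1 then extV v j else 1.

Definition opR v i : \bar R :=
  ((a i)%:E * (1 - (shiftV v i)%:E^-1) + (b i * (1 - extV v i))%:E)%E.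

Definition FII : set (nat -> R) :=
  [set f | forall i, E N i -> 0 < f i].

Definition FI : set (nat -> R) :=
  [set f | (forall i, E N i -> 0 < f i) /\
           (forall i j, E N j -> (i < j)%N -> f j < f i)].

Definition V1 : set (nat -> R) :=
  [set v | ((\esum_(j in E N) (nu j)%:E < +oo)%E ->
              forall i, ltN i N -> 0 < v i < 1) /\
           (\esum_(j in E N) (nu j)%:E = +oo%E ->
              forall i, ltN i N -> 0 < v i <= 1)].

Definition FII_fin : set (nat -> R) :=
  [set f | exists m, [/\ (1 <= m)%N, E N m,
      forall i, (i <= m)%N -> 0 < f i &
      forall i, E N i -> (m < i)%N -> f i = 0]].

Definition FI_fin : set (nat -> R) :=
  [set f | exists n m, [/\ (n < m)%N /\ E N m,
      forall i, (i <= n)%N -> f i = f n,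
      forall i j, (n <= i)%N -> (i < j)%N -> (j <= m)%N -> f j < f i,
      0 < f m &
      forall i, E N i -> (m < i)%N -> f i = 0]].

Definition V1_fin : set (nat -> R) :=
  [set v | exists m, [/\ (1 <= m)%N, E N m,
      forall i, (i < m)%N ->
        a i.+1 / (a i.+1 + b i.+1) < v i
          < 1 - a i * ((shiftV v i)^-1 - 1) / b i &
      forall i, ltN i N -> (m <= i)%N -> v i = 0]].

Definition attained (T : Type) (A : set T) (F : T -> \bar R) : Prop :=
  exists2 x, A x & F x = ereal_sup (F @` A).

End Setting.

(* Main.v *)
(** All six variational quantities are governed by the difference form. For
    positive [u], the inequality [(x - y)^2 >= (1 - u) x^2 + (1 - 1/u) y^2]
    summed along the chain bounds the Dirichlet form below by the [R_i(u)]-weighted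
    norm, with equality when [h_(i+1) = u_i h_i]; this gives both comparisons of
    [R_i] with the Rayleigh quotients. A double-summation test function [f] is
    turned into a difference-form one through the ratios of the truncated sums
    [g_i = sum_(i <= j <= m) nu_j sum_(k <= j) mu_k f_k], for which
    [R_i = f_i / g_i], and a single-summation one becomes a double-summation one
    by telescoping.

    Sharpness comes from the solution [g] of the eigenvalue recursion started at
    [g_0 = 1]. At [lambda_0] it stays positive on [E], since otherwise a perturbed
    truncation of [g] would have a Rayleigh quotient below [lambda_0]; at any
    larger parameter it becomes nonpositive somewhere, and cutting it off there
    yields nearly optimal finitely supported functions. *)
Require Import Defs.
From HB Require Import structures.
From mathcomp Require Import all_boot all_order all_algebra.
From mathcomp Require Import all_classical all_reals all_analysis.
From mathcomp Require Import ring lra zify.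
Set Implicit Arguments.
Unset Strict Implicit.
Unset Printing Implicit Defensive.
Import Order.TTheory GRing.Theory Num.Theory.
Local Open Scope classical_set_scope.
Local Open Scope ereal_scope.

Section BirthDeath.
Local Open Scope ring_scope.
Variables (R : realType) (N : option nat) (a b : nat -> R).
Hypothesis hab : rates a b N.
Implicit Types (f g h u v : nat -> R) (c l : R).

Local Notation mu := (mu a b).
Local Notation nu := (nu a b).

(** * Index set, rates and weighted partial sums *)

Lemma E_le i j : E N j -> (i <= j)%N -> E N i.
Proof. by rewrite /E /=; case: N => [n|] //= ? ?; lia. Qed.

Lemma E_ltN i : E N i.+1 -> ltN i N.
Proof. by rewrite /E /=; case: N => [n|]. Qed.

Lemma ltN_E i : ltN i N -> E N i.+1.
Proof. by rewrite /E /=; case: N => [n|]. Qed.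

Lemma extE_E f i : E N i -> extE N f i = f i.
Proof. by rewrite /E /extE /= => ->. Qed.

Lemma a_gt0 i : E N i.+1 -> 0 < a i.+1.
Proof. by case: hab => _ h _ Ei; exact: h. Qed.

Lemma b_gt0 i : E N i -> 0 < b i.
Proof. by case: hab => _ _; apply. Qed.

Lemma a0 : a 0%N = 0. Proof. by case: hab. Qed.

Lemma mu0 : mu 0 = 1.
Proof. by rewrite /Defs.mu !big_ord0 divr1. Qed.

Lemma muS i : E N i.+1 -> mu i.+1 * a i.+1 = mu i * b i.
Proof.
move=> Ei; have := a_gt0 Ei => /lt0r_neq0 ai; rewrite /Defs.mu.
rewrite !big_ord_recr /= invfM; move: (\prod_(_ < _) _)^-1 => P.
by field.
Qed.

Lemma mu_gt0 i : E N i -> 0 < mu i.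
Proof.
elim: i => [|i ih] Ei; first by rewrite mu0.
rewrite -(pmulr_lgt0 _ (a_gt0 Ei)) muS// mulr_gt0// ?b_gt0 ?ih//;
exact: E_le Ei _.
Qed.

Lemma mub_gt0 i : E N i -> 0 < mu i * b i.
Proof. by move=> Ei; rewrite mulr_gt0 ?mu_gt0 ?b_gt0. Qed.

Lemma nu_gt0 i : E N i -> 0 < nu i.
Proof. by move=> Ei; rewrite invr_gt0 mub_gt0. Qed.

Definition psum f n : R := \sum_(k < n.+1) mu k * f k.

Lemma psum0 f : psum f 0 = f 0%N.
Proof. by rewrite /psum big_ord_recr big_ord0 /= mu0; ring. Qed.

Lemma psumS f n : psum f n.+1 = psum f n + mu n.+1 * f n.+1.
Proof. by rewrite /psum big_ord_recr. Qed.

Lemma psum_gt0 f n : E N n -> (forall i, (i <= n)%N -> 0 < f i) ->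
  0 < psum f n.
Proof.
elim: n => [_ h|n ih En h]; first by rewrite psum0 h.
rewrite psumS; apply: addr_gt0; last by rewrite mulr_gt0 ?mu_gt0 ?h.
by apply: ih => [|i le_in]; [exact: E_le En _ | apply: h; lia].
Qed.

(** * Comparison of the difference operator with the Dirichlet form *)

Definition drift u i : R :=
  a i * (1 - (if i is j.+1 then u j else 1)^-1) + b i * (1 - u i).

(** Induction on [m]: by detailed balance ([muS]) the death term at [m + 1] joins the birth term at
    [m] on one edge. There the defect of the inequality is the square [w^-1 (w x - y)^2]. The last
    summand is the birth term at [m], not yet paired. *)
Lemma dirichlet_ge u h m : E N m -> (forall i, (i < m)%N -> 0 < u i) ->
  \sum_(i < m.+1) mu i * h i ^+ 2 * drift u i <=
  \sum_(i < m) mu i * b i * (h i - h i.+1) ^+ 2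
  + mu m * b m * (1 - u m) * h m ^+ 2.
Proof.
elim: m => [_ _|m ih Em u0].
  rewrite big_ord_recr !big_ord0 /drift /= a0 le_eqVlt; apply/orP; left.
  by apply/eqP; ring.
have Em' := E_le Em (leqnSn m).
have {}ih := ih Em' (fun i im => u0 i (ltnW im)).
rewrite big_ord_recr [in leRHS]big_ord_recr /=.
set s := \sum_(i < m.+1) _ in ih *; set t := \sum_(i < m) _ in ih *.
have um := u0 m (ltnSn m); rewrite /drift.
set x := h m in ih *; set y := h m.+1; set w := u m in ih um *.
have -> : mu m.+1 * y ^+ 2 * (a m.+1 * (1 - w^-1) + b m.+1 * (1 - u m.+1)) =
  mu m * b m * (1 - w^-1) * y ^+ 2 + mu m.+1 * b m.+1 * (1 - u m.+1) * y ^+ 2.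
  by rewrite -muS//; ring.
suff : mu m * b m * ((1 - w) * x ^+ 2 + (1 - w^-1) * y ^+ 2) <=
       mu m * b m * (x - y) ^+ 2 by lra.
rewrite ler_pM2l ?mub_gt0// -subr_ge0.
have -> : (x - y) ^+ 2 - ((1 - w) * x ^+ 2 + (1 - w^-1) * y ^+ 2)
  = w^-1 * (w * x - y) ^+ 2 by field; lra.
by rewrite mulr_ge0 ?sqr_ge0 ?invr_ge0 ?ltW.
Qed.

(** The square defect on each edge vanishes because [h] has successive ratios [u]. *)
Lemma dirichlet_eq u h m : E N m -> (forall i, (i < m)%N -> 0 < u i) ->
  (forall i, (i < m)%N -> h i.+1 = u i * h i) ->
  \sum_(i < m.+1) mu i * h i ^+ 2 * drift u i =
  \sum_(i < m) mu i * b i * (h i - h i.+1) ^+ 2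
  + mu m * b m * (1 - u m) * h m ^+ 2.
Proof.
elim: m => [_ _ _|m ih Em u0 hu].
  by rewrite big_ord_recr !big_ord0 /drift /= a0; ring.
have {}ih := ih (E_le Em (leqnSn m)) (fun i im => u0 i (ltnW im))
  (fun i im => hu i (ltnW im)).
rewrite big_ord_recr [in RHS]big_ord_recr /= ih /drift hu//.
have um := u0 m (ltnSn m).
rewrite [mu m.+1 * _ * (_ + _)](_ : _ =
  mu m.+1 * a m.+1 * (1 - (u m)^-1) * (u m * h m) ^+ 2 +
  mu m.+1 * b m.+1 * (1 - u m.+1) * (u m * h m) ^+ 2); last by ring.
by rewrite muS//; field; lra.
Qed.

(** Real-number form of [c <= lambda0]. The condition [h m.+1 = 0] covers both the end of the
    support and, for [m = N], the Dirichlet boundary. *)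
Definition rayleigh_lb c := forall m h, E N m -> h m.+1 = 0 ->
  c * (\sum_(i < m.+1) mu i * h i ^+ 2) <=
  \sum_(i < m.+1) mu i * b i * (h i - h i.+1) ^+ 2.

Lemma rayleigh_of_drift u c m h : E N m -> h m.+1 = 0 ->
  (forall i, (i < m)%N -> 0 < u i) -> 0 <= u m ->
  (forall i, (i <= m)%N -> c <= drift u i) ->
  c * (\sum_(i < m.+1) mu i * h i ^+ 2) <=
  \sum_(i < m.+1) mu i * b i * (h i - h i.+1) ^+ 2.
Proof.
move=> Em hm u0 um cu; rewrite big_distrr /=.
apply: (@le_trans _ _ (\sum_(i < m.+1) mu i * h i ^+ 2 * drift u i)).
  apply: ler_sum => i _; rewrite mulrC ler_wpM2l ?cu//; last by case: i.
  by rewrite mulr_ge0 ?sqr_ge0// ltW ?mu_gt0//; apply: E_le Em _; case: i.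
apply: (le_trans (dirichlet_ge h Em u0)).
(* Only the boundary edge remains: its energy is the full [h m ^+ 2], which dominates the factor
   [1 - u m] since [u m >= 0]. *)
rewrite [leRHS]big_ord_recr /= hm subr0 lerD2l -mulrA ler_wpM2l//.
  by rewrite ltW ?mub_gt0.
rewrite -subr_ge0; have -> : h m ^+ 2 - (1 - u m) * h m ^+ 2 = u m * h m ^+ 2.
  by ring.
by rewrite mulr_ge0 ?sqr_ge0.
Qed.

(** The test function is the product of the [u k]. Since [u m = 0] it vanishes at [m + 1], so its
    full Dirichlet form is the [drift]-weighted norm, which is at most [c] times the norm. *)
Lemma drift_ge_of_rayleigh u c l m : rayleigh_lb l -> E N m ->
  (forall i, (i < m)%N -> 0 < u i) -> u m = 0 ->
  (forall i, (i <= m)%N -> drift u i <= c) -> l <= c.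
Proof.
move=> Hl Em u0 um cu; pose h i := \prod_(k < i) u k.
have hS i : h i.+1 = u i * h i by rewrite /h big_ord_recr /= mulrC.
have {Hl} := Hl m h Em; rewrite hS um mul0r => /(_ erefl) Hl.
have := @dirichlet_eq u h m Em u0 (fun i _ => hS i).
rewrite um subr0 mulr1 => Heq.
rewrite [leRHS]big_ord_recr /= hS um mul0r subr0 -{}Heq in Hl.
have pos : 0 < \sum_(i < m.+1) mu i * h i ^+ 2.
  rewrite big_ord_recl /= mu0 /h big_ord0 expr1n mulr1 ltr_pwDl//.
  apply: sumr_ge0 => i _.
  by rewrite mulr_ge0 ?sqr_ge0// ltW ?mu_gt0//; apply: E_le Em _; case: i.
rewrite -(ler_pM2r pos); apply: (le_trans Hl); rewrite big_distrr /=.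
apply: ler_sum => i _; rewrite [leRHS]mulrC ler_wpM2l ?cu//; last by case: i.
by rewrite mulr_ge0 ?sqr_ge0// ltW ?mu_gt0//; apply: E_le Em _; case: i.
Qed.

(** * Fluxes, ratios and truncated double sums *)

Definition ratio g i : R := g i.+1 / g i.
Definition flux g i : R := mu i * b i * (g i - g i.+1).

Lemma drift_ratio g i : E N i -> (forall j, (j <= i)%N -> 0 < g j) ->
  mu i * g i * drift (ratio g) i =
  flux g i - (if i is j.+1 then flux g j else 0).
Proof.
move=> Ei g0; have gi := g0 _ (leqnn i); rewrite /drift /ratio /flux.
case: i => [|i] in Ei g0 gi *; first by rewrite a0 mu0; field; lra.
have gi' := g0 i (leqnSn i).
rewrite -(muS Ei) invfM invrK; field; lra.
Qed.

Definition tail f m i : R := \sum_(i <= j < m.+1) nu j * psum f j.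

Lemma eq_tail f g m i : (forall j, (j <= m)%N -> f j = g j) ->
  tail f m i = tail g m i.
Proof.
move=> fg; apply: eq_big_nat => j /andP[_ jm]; congr (_ * _).
by apply: eq_bigr => k _; rewrite fg//; have := ltn_ord k; lia.
Qed.

Lemma tail_end f m : tail f m m.+1 = 0.
Proof. by rewrite /tail big_geq. Qed.

Lemma tail_rec f m i : (i <= m)%N ->
  tail f m i = nu i * psum f i + tail f m i.+1.
Proof. by move=> im; rewrite /tail big_ltn. Qed.

Lemma tail_gt0 f m i : E N m -> (forall j, (j <= m)%N -> 0 < f j) ->
  (i <= m)%N -> 0 < tail f m i.
Proof.
move=> Em f0 im; rewrite -(subKn im); have := leq_subr i m.
elim: (m - i)%N => [_|k ih km]; last rewrite tail_rec ?leq_subr//.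
  rewrite subn0 tail_rec// tail_end addr0 mulr_gt0 ?nu_gt0//.
  exact: psum_gt0.
apply: addr_gt0; last by rewrite subnSK// ih// ltnW.
have Ek : E N (m - k.+1)%N by apply: E_le Em _; lia.
rewrite mulr_gt0 ?nu_gt0 ?psum_gt0// => j jm; apply: f0; lia.
Qed.

Lemma flux_tail f m i : E N m -> (i <= m)%N -> flux (tail f m) i = psum f i.
Proof.
move=> Em im; rewrite /flux tail_rec// addrK mulrA /Defs.nu mulfV ?mul1r//.
by rewrite lt0r_neq0// mub_gt0//; exact: E_le Em _.
Qed.

(** [tail f m] solves the Poisson equation with right-hand side [f] and zero value at [m + 1]: its
    flux at [i] is [psum f i], and consecutive fluxes differ by [mu i * f i]. *)
Lemma drift_tail f m i : E N m -> (forall j, (j <= m)%N -> 0 < f j) ->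
  (i <= m)%N -> drift (ratio (tail f m)) i = f i / tail f m i.
Proof.
move=> Em f0 im; have Ei := E_le Em im.
have t0 j : (j <= m)%N -> 0 < tail f m j by exact: tail_gt0.
have mi := mu_gt0 Ei; have ti := t0 _ im.
apply: (mulfI (_ : mu i * tail f m i != 0)); first by rewrite lt0r_neq0// mulr_gt0.
rewrite drift_ratio// => [|j ji]; last by apply: t0; lia.
rewrite flux_tail//; transitivity (mu i * f i); last by field; lra.
case: i => [|i] in im Ei mi ti *; first by rewrite psum0 mu0; ring.
by rewrite flux_tail// ?psumS; [ring|lia].
Qed.

(* It suffices to cut the inner tail off at the end of the support of the test
   function, so that no infinite sum enters the comparison. *)
Lemma rayleigh_of_tail f c : (forall i, E N i -> 0 < f i) ->
  (forall m i, E N m -> (i <= m)%N -> c * tail f m i <= f i) ->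
  rayleigh_lb c.
Proof.
move=> f0 Hc m h Em hm.
have f0' j : (j <= m)%N -> 0 < f j by move=> jm; apply: f0; exact: E_le Em _.
apply: (@rayleigh_of_drift (ratio (tail f m))) => // [i im||i im].
- by rewrite divr_gt0// tail_gt0// ltnW.
- by rewrite /ratio tail_end mul0r.
- by rewrite drift_tail// ler_pdivlMr ?tail_gt0// Hc.
Qed.

Lemma rayleigh_le_tail f l c m : rayleigh_lb l -> E N m ->
  (forall i, (i <= m)%N -> 0 < f i) ->
  (forall i, (i <= m)%N -> f i <= c * tail f m i) -> l <= c.
Proof.
move=> Hl Em f0 Hc.
apply: (@drift_ge_of_rayleigh (ratio (tail f m)) c l m) => // [i im||i im].
- by rewrite divr_gt0// tail_gt0// ltnW.
- by rewrite /ratio tail_end mul0r.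
- by rewrite drift_tail// ler_pdivrMr ?tail_gt0// Hc.
Qed.

(** Dividing the flux inequality by [mu j * b j] bounds the increments of [g], which telescope from
    [i] to [m + 1]. *)
Lemma tail_le_of_flux f g c m i : E N m -> (i <= m)%N -> 
  (forall j, (j <= m)%N -> c * psum f j <= flux g j) ->
  c * tail f m i <= g i - g m.+1.
Proof.
move=> Em im H; rewrite /tail -[leRHS]opprB -telescope_sumr; last by lia.
rewrite -sumrN mulr_sumr ler_sum_nat// => j /andP[ij jm].
have Ej : E N j by apply: E_le Em _; lia.
have nj := nu_gt0 Ej; rewrite mulrCA opprB mulrC -ler_pdivlMr//.
by rewrite /Defs.nu invrK [leRHS]mulrC; apply: H; lia.
Qed.

Lemma le_tail_of_flux f g c m i : E N m -> (i <= m)%N ->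
  (forall j, (i <= j <= m)%N -> flux g j <= c * psum f j) ->
  g i - g m.+1 <= c * tail f m i.
Proof.
move=> Em im H; rewrite /tail -[leLHS]opprB -telescope_sumr; last by lia.
rewrite -sumrN mulr_sumr ler_sum_nat// => j /andP[ij jm].
have Ej : E N j by apply: E_le Em _; lia.
have nj := nu_gt0 Ej; rewrite mulrCA opprB [leRHS]mulrC -ler_pdivrMr//.
by rewrite /Defs.nu invrK [leLHS]mulrC; apply: H; lia.
Qed.

(** * The eigenvalue recursion and its positivity *)

Fixpoint eig_psum l n : R * R :=
  if n is k.+1 then
    let: (x, s) := eig_psum l k in
    let y := x - l * nu k * s in (y, s + mu k.+1 * y)
  else (1, 1).

(* Solution of the eigenvalue equation with parameter [l], with no condition at
   the right end; [eig_psum] carries its [mu]-weighted partial sums along. *)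
Definition eig l n : R := (eig_psum l n).1.

Lemma eig0 l : eig l 0 = 1. Proof. by []. Qed.

Lemma eigS l n : eig l n.+1 = eig l n - l * nu n * psum (eig l) n.
Proof.
have eq2 k : (eig_psum l k).2 = psum (eig l) k.
  elim: k => [|k ih]; first by rewrite psum0.
  by rewrite psumS -ih /eig /=; case: (eig_psum l k).
by rewrite -eq2 /eig /=; case: (eig_psum l n).
Qed.

Lemma flux_eig l n : E N n -> flux (eig l) n = l * psum (eig l) n.
Proof.
move=> En; have p := lt0r_neq0 (mub_gt0 En); rewrite /flux eigS.
have -> : mu n * b n * (eig l n - (eig l n - l * nu n * psum (eig l) n))
        = (mu n * b n * nu n) * (l * psum (eig l) n) by ring.
by rewrite /Defs.nu mulfV// mul1r.
Qed.

(** Summation by parts: fluxes at consecutive sites differ by [l * mu i * eig l i], and only the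
    boundary term at [m] survives. *)
Lemma eig_energy l m : E N m ->
  \sum_(i < m) mu i * b i * (eig l i - eig l i.+1) ^+ 2 =
  l * (\sum_(i < m.+1) mu i * eig l i ^+ 2) - eig l m * flux (eig l) m.
Proof.
elim: m => [|m ih] Em.
  by rewrite big_ord_recr !big_ord0 /= flux_eig// psum0 mu0; ring.
have Em' := E_le Em (leqnSn m).
rewrite big_ord_recr [in RHS]big_ord_recr /= ih// [flux _ m.+1]flux_eig//.
have -> : mu m * b m * (eig l m - eig l m.+1) ^+ 2 =
          flux (eig l) m * (eig l m - eig l m.+1) by rewrite /flux; ring.
by rewrite psumS flux_eig//; ring.
Qed.

(** If [eig l] first failed to be positive at [m + 1], a truncation with a corrected positive value
    there would have Rayleigh quotient below [l]. *)
Lemma eig_gt0 l m : rayleigh_lb l -> 0 <= l -> E N m -> 0 < eig l m.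
Proof.
move=> Hl l0; elim: m => [_|m ih Em]; first by rewrite eig0.
have Em' := E_le Em (leqnSn m); have {ih} G0 := ih Em'.
rewrite ltNge; apply/negP => X0.
have a_gt := a_gt0 Em; have b_gt := b_gt0 Em; have mu_gt := mu_gt0 Em.
(* [t] minimizes the Dirichlet form among the extensions of [eig l] to [m + 1]. *)
pose t := a m.+1 * eig l m / (a m.+1 + b m.+1).
pose h i := if (i <= m)%N then eig l i else if i == m.+1 then t else 0.
have hm : h m.+2 = 0 by rewrite /h ifF ?ifF//; lia.
have := Hl m.+1 h Em hm.
rewrite big_ord_recr [in leRHS]big_ord_recr [in leRHS]big_ord_recr /= hm subr0.
have -> : h m.+1 = t by rewrite /h ltnn eqxx.
have -> : h m = eig l m by rewrite /h leqnn.
under eq_bigr => i _ do rewrite {1}/h -ltnS ltn_ord.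
under [in leRHS]eq_bigr => i _ do
  rewrite {1}/h (ltnW (ltn_ord i)) {1}/h (ltn_ord i).
rewrite eig_energy// /flux -(muS Em).
have et : (a m.+1 + b m.+1) * t = a m.+1 * eig l m by rewrite /t; field; lra.
set S := \sum_(_ < _) _; set G := eig l m in et G0 *.
set X := eig l m.+1 in X0 *.
set A := a m.+1 in et a_gt *; set B := b m.+1 in et b_gt *.
set M := mu m.+1 in mu_gt *.
have t0 : 0 < t by rewrite divr_gt0 ?mulr_gt0 ?addr_gt0.
clearbody t S G X A B M; apply/negP; rewrite -ltNge -subr_gt0.
(* This is [l] times the squared norm of [h] minus its energy. Since [(A + B) t = A G], the last
   summand is [M t A G > 0]; the second is nonnegative because [X <= 0]. *)
have -> : l * (S + M * t ^+ 2) - (l * S - G * (M * A * (G - X))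
  + M * A * (G - t) ^+ 2 + M * B * t ^+ 2)
  = l * M * t ^+ 2 + M * A * G * (- X)
    + M * t * (2 * (A * G) - (A + B) * t) by ring.
rewrite et; apply: ltr_wpDl; last first.
  have -> : 2 * (A * G) - A * G = A * G by ring.
  by rewrite !mulr_gt0.
apply: addr_ge0; first by rewrite !mulr_ge0 ?sqr_ge0// ltW.
by rewrite !mulr_ge0 ?oppr_ge0// ltW.
Qed.

(** This reaches the index [N + 1] outside [E]. For the plain truncation of [eig l] at [m], energy
    minus [l] times squared norm is a positive multiple of [eig l m.+1]. *)
Lemma eig_next_ge0 l m : rayleigh_lb l -> 0 <= l -> E N m -> 0 <= eig l m.+1.
Proof.
move=> Hl l0 Em; have G0 := eig_gt0 Hl l0 Em.
pose h i := if (i <= m)%N then eig l i else 0.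
have hm : h m.+1 = 0 by rewrite /h ltnn.
have := Hl m h Em hm.
rewrite [in leRHS]big_ord_recr /= hm subr0.
have -> : h m = eig l m by rewrite /h leqnn.
under eq_bigr => i _ do rewrite {1}/h -ltnS ltn_ord.
under [in leRHS]eq_bigr => i _ do
  rewrite {1}/h (ltnW (ltn_ord i)) {1}/h (ltn_ord i).
rewrite eig_energy// /flux; set S := \sum_(_ < _) _; rewrite -subr_ge0.
have -> : l * S - eig l m * (mu m * b m * (eig l m - eig l m.+1))
  + mu m * b m * eig l m ^+ 2 - l * S
  = (mu m * b m * eig l m) * eig l m.+1 by ring.
by rewrite pmulr_rge0// mulr_gt0// mub_gt0.
Qed.

(** If [eig c] stayed positive, including at [N + 1] for finite [N], its flux identity would
    telescope to [c * tail <= eig c], making [c] a Rayleigh lower bound above the largest one. *)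
Lemma eig_escape l c : (forall c', rayleigh_lb c' -> c' <= l) -> l < c ->
  exists m, [/\ E N m, forall i, (i <= m)%N -> 0 < eig c i & eig c m.+1 <= 0].
Proof.
move=> Hl lc; apply: contrapT => /forallNP H.
have step m : E N m -> (forall i, (i <= m)%N -> 0 < eig c i) ->
  0 < eig c m.+1.
  by move=> Em pos; rewrite ltNge; apply/negP => neg; exact: (H m).
have pos m : E N m -> forall i, (i <= m)%N -> 0 < eig c i.
  elim: m => [_ i|m ih Em i]; first by rewrite leqn0 => /eqP->; rewrite eig0.
  have Em' := E_le Em (leqnSn m).
  by rewrite leq_eqVlt => /predU1P[->|/(ih Em')//]; apply: step => //; exact: ih.
suff /Hl : rayleigh_lb c by rewrite leNgt lc.
apply: (@rayleigh_of_tail (eig c)) => [i Ei|m i Em im]; first exact: pos Ei _ _.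
apply: (le_trans (@tail_le_of_flux (eig c) (eig c) c m i Em im _)).
  by move=> j jm; rewrite flux_eig//; exact: E_le Em _.
by rewrite gerBl ltW// step//; exact: pos.
Qed.

(** * Sums over [E] and the real value of [lambda0] *)

Lemma esum_E (F : nat -> R) m : E N m -> (forall i, E N i -> 0 <= F i) ->
  (forall i, E N i -> (m < i)%N -> F i = 0) ->
  \esum_(i in E N) (F i)%:E = (\sum_(i < m.+1) F i)%:E.
Proof.
move=> Em F0 Fm.
rewrite -sumEFin (@fsbig_ord _ _ _ m.+1 (fun i => (F i)%:E)) -esum_fset//=; last first.
  by move=> i; rewrite inE/= lee_fin => im; apply: F0; exact: E_le Em _.
rewrite [in LHS]esum_mkcond [in RHS]esum_mkcond; apply: eq_esum => i _.
have [im|im] := leqP i m.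
  by rewrite !mem_set//; exact: E_le Em im.
rewrite [X in _ = if X then _ else _]memNset; last by rewrite /= ltnS; lia.
by have [Ei|Ei] := pselect (E N i); [rewrite mem_set// Fm|rewrite memNset].
Qed.

Lemma finite_sub_E (X : set nat) : finite_set X -> X `<=` E N ->
  exists2 m, E N m & X `<=` [set i | (i <= m)%N].
Proof.
move=> finX XE; case: N XE => [n|] XE; first by exists n => //; rewrite /E /=.
exists (\max_(i <- finmap.enum_fset (fset_set X)) i)%N => // i Xi.
by apply: leq_bigmax_seq => //; rewrite in_fset_set// inE.
Qed.

Lemma lambda0P : exists l, [/\ lambda0 a b N = l%:E, 0 <= l, rayleigh_lb l &
  forall c, rayleigh_lb c -> c <= l].
Proof.
have ext0 m h i : (forall i, E N i -> (m < i)%N -> h i = 0) -> (m < i)%N ->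
  extE N h i = 0 by rewrite /extE; case: ifP => // Ei h0 mi; exact: h0.
have dir m h : E N m -> (forall i, E N i -> (m < i)%N -> h i = 0) ->
  Defs.D a b N h =
  (\sum_(i < m.+1) mu i * b i * (extE N h i - extE N h i.+1) ^+ 2)%:E.
  move=> Em hm; rewrite /Defs.D (esum_E Em).
  - by congr EFin; apply: eq_bigr => i _; rewrite -[in RHS]sqrrN opprB.
  - by move=> i Ei; rewrite mulr_ge0 ?sqr_ge0// ltW ?mub_gt0.
  - by move=> i Ei im; rewrite !(ext0 m) => //; [ring|lia].
have nrm m h : E N m -> (forall i, E N i -> (m < i)%N -> h i = 0) ->
  normL2 a b N h = (Num.sqrt (\sum_(i < m.+1) mu i * h i ^+ 2))%:E.
  move=> Em hm; rewrite /normL2 (esum_E Em)//.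
  - by move=> i Ei; rewrite mulr_ge0 ?sqr_ge0// ltW ?mu_gt0.
  - by move=> i Ei im; rewrite hm//; ring.
pose cut h m i := if (i <= m)%N then h i else 0 : R.
have cutK m h : K N (cut h m).
  apply: (@sub_finite_set _ _ `I_m.+1); last exact: finite_II.
  by move=> i [_ /=]; rewrite /cut ltnS; case: ifP => //; rewrite eqxx.
have cut0 m h i : (m < i)%N -> cut h m i = 0 by move=> im; rewrite /cut leqNgt im.
have E0 : E N 0 by rewrite /E /=; case: N.
have L_ge0 : (0 <= lambda0 a b N)%E.
  apply: le_ereal_inf_tmp => _ [f _ <-]; apply: esum_ge0 => i Ei.
  by rewrite lee_fin mulr_ge0 ?sqr_ge0// ltW ?mub_gt0.
(* The indicator of 0 has norm 1 and energy [b 0], which rules out the value [+oo]. *)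
have L_fin : (lambda0 a b N <= (b 0)%:E)%E.
  apply: ereal_inf_lbound; exists (cut (fun=> 1) 0); first split => //.
    rewrite (nrm 0)// => [|i _]; last exact: cut0.
    by rewrite big_ord_recr big_ord0 /= mu0 /cut /= expr1n mul1r add0r sqrtr1.
  rewrite (dir 0)// => [|i _]; last exact: cut0.
  rewrite big_ord_recr big_ord0 /= mu0 extE_E// /cut /=.
  rewrite /extE if_same; congr EFin; ring.
case Ll : (lambda0 a b N) L_ge0 L_fin => [l| |]//.
rewrite lee_fin => l0 _; exists l; split=> //.
- move=> m h Em hm.
  set n2 := \sum_(i < m.+1) mu i * h i ^+ 2.
  have sumE (k : 'I_m.+1) : E N k by apply: E_le Em _; case: k.
  have lem (k : 'I_m.+1) : (k <= m)%N by case: k.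
  have n2_ge0 : 0 <= n2.
    by apply: sumr_ge0 => i _; rewrite mulr_ge0 ?sqr_ge0// ltW ?mu_gt0.
  (* A function of norm zero cannot be normalized, but then the left side is zero. *)
  have [n20|n2_neq0] := eqVneq n2 0.
    rewrite n20 mulr0 sumr_ge0// => i _.
    by rewrite mulr_ge0 ?sqr_ge0// ltW ?mub_gt0.
  have n2_gt0 : 0 < n2 by rewrite lt_neqAle eq_sym n2_neq0.
  have s_gt0 : 0 < Num.sqrt n2 by rewrite sqrtr_gt0.
  pose f := cut (fun i => h i / Num.sqrt n2) m.
  have f0 i : (m < i)%N -> f i = 0 by exact: cut0.
  have fE i : (i <= m)%N -> f i = h i / Num.sqrt n2 by rewrite /f /cut => ->.
  have s2 : Num.sqrt n2 ^+ 2 = n2 by rewrite sqr_sqrtr.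
  have normf : normL2 a b N f = 1%E.
    rewrite (nrm m)// => [|i _]; last exact: f0.
    suff -> : \sum_(i < m.+1) mu i * f i ^+ 2 = 1.
      by rewrite sqrtr1.
    under eq_bigr => i _ do rewrite fE ?lem// expr_div_n s2 mulrA.
    by rewrite -mulr_suml mulfV.
  have : (l%:E <= Defs.D a b N f)%E.
    rewrite -Ll; apply: ereal_inf_lbound; exists f => //; split=> //.
    exact: cutK.
  rewrite (dir m)// => [|i _]; last exact: f0.
  rewrite lee_fin -(ler_pM2r n2_gt0) => /le_trans; apply.
  rewrite big_distrl /= ler_sum// => i _.
  rewrite extE_E//.
  have -> : extE N f i.+1 = h i.+1 / Num.sqrt n2.
    have [im|im] := leqP i.+1 m.
      by rewrite extE_E ?fE//; exact: E_le Em _.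
    have -> : i.+1 = m.+1 by have := ltn_ord i; lia.
    by rewrite /extE f0// if_same hm mul0r.
  rewrite fE ?lem// -mulrBl expr_div_n s2 -!mulrA mulVf// mulr1.
  by rewrite mulrA.
- move=> c Hc; rewrite -lee_fin -Ll.
  apply: le_ereal_inf_tmp => _ [f [fK fn] <-].
  have [m [Em fm]] : exists m, E N m /\ forall i, E N i -> (m < i)%N -> f i = 0.
    have [m Em fm] := finite_sub_E fK (fun i (H : supp N f i) => proj1 H).
    exists m; split=> // i Ei; rewrite ltnNge; apply: contraNeq => fi.
    exact: fm.
  have {}fn : \sum_(i < m.+1) mu i * f i ^+ 2 = 1.
    move: fn; rewrite (nrm m)// => -[fn].
    rewrite -[LHS]sqr_sqrtr ?fn ?expr1n// sumr_ge0// => i _.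
    rewrite mulr_ge0 ?sqr_ge0// ltW// mu_gt0//; apply: E_le Em _.
    by case: i.
  rewrite (dir m)// lee_fin -[leLHS]mulr1 -fn.
  have := Hc m (extE N f) Em (ext0 m f _ fm (ltnSn m)).
  apply: le_trans; rewrite le_eqVlt; apply/orP; left; apply/eqP.
  congr (_ * _); apply: eq_bigr => i _; rewrite extE_E//.
  by apply: E_le Em _; case: i.
Qed.

(** * The extended-real operators in terms of real quantities *)

Lemma flux_extE_ge f i : E N i -> 0 <= f i.+1 -> flux f i <= flux (extE N f) i.
Proof.
move=> Ei fi; rewrite /flux extE_E// ler_pM2l ?mub_gt0// lerD2l lerN2.
by rewrite /extE; case: ifP.
Qed.

(** At [x = 0] the conventions give [+oo^-1 = 0], which agrees with [x / t]. *)
Lemma inve_opI_fin (x t : R) : 0 < t -> ((x%:E^-1 * t%:E)^-1 = (x / t)%:E)%E.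
Proof.
move=> t0; rewrite inver; have [->|x0] := eqVneq x 0.
  by rewrite gt0_mulye ?lte_fin// invey mul0r.
rewrite -EFinM inver invfM invrK mulf_eq0 invr_eq0 (negbTE x0).
by rewrite (gt_eqF t0).
Qed.

Lemma opI_inv f i : 0 < psum f i ->
  ((opI a b N f i)^-1 = (flux (extE N f) i / psum f i)%:E)%E.
Proof. exact: inve_opI_fin. Qed.

Lemma inve_opII_gt0 (x : R) (T : \bar R) : 0 < x -> (0 < T)%E ->
  ((x%:E^-1 * T)^-1 = x%:E * T^-1)%E.
Proof.
move=> x0; case: T => [t||]//; rewrite ?lte_fin => t0.
  by rewrite inve_opI_fin// inver (gt_eqF t0) EFinM.
by rewrite inver (gt_eqF x0) gt0_muley ?lte_fin ?invr_gt0// invey mule0.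
Qed.

Lemma esum_tail_ge f m i : E N m -> (forall j, (j <= m)%N -> f j != 0) ->
  ((tail f m i)%:E <=
   \esum_(j in supp N f `&` [set j | (i <= j)%N]) (nu j * psum f j)%:E)%E.
Proof.
move=> Em f0; apply: esum_ge; exists [set` index_iota i m.+1].
  split; first exact: finite_seq.
  move=> j /=; rewrite mem_index_iota ltnS => /andP[ij jm]; split=> //.
  by split; [exact: E_le Em jm|exact: f0].
by rewrite -fsbig_seq ?iota_uniq// sumEFin.
Qed.

(** Any finite set of indices in [E] lies below some [m] in [E], so finite partial sums are
    dominated by finite tails. *)
Lemma esum_tail_le f i (x : R) : (forall j, E N j -> 0 <= f j) ->
  (forall m, E N m -> (i <= m)%N -> tail f m i <= x) -> 0 <= x ->
  (\esum_(j in supp N f `&` [set j | (i <= j)%N]) (nu j * psum f j)%:E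
   <= x%:E)%E.
Proof.
move=> f0 H x0; apply: ge_ereal_sup => _ [X [finX XS] <-].
have XE : X `<=` E N by move=> j /XS [[]].
have [m Em Xm] := finite_sub_E finX XE.
have psum_ge0 j : E N j -> 0 <= psum f j.
  move=> Ej; apply: sumr_ge0 => k _.
  have Ek : E N k by apply: E_le Ej _; case: k.
  by rewrite mulr_ge0 ?f0// ltW// mu_gt0.
apply: (@le_trans _ _ (tail f m i)%:E).
  rewrite /tail -sumEFin (@fsbig_seq _ _ _ _ (index_iota i m.+1)) ?iota_uniq//.
  apply: lee_fsum_nneg_subset => //.
    move=> j /set_mem Xj; apply/mem_set => /=.
    by rewrite mem_index_iota ltnS; have [_ /= ->] := XS _ Xj; exact: Xm.
  move=> j /andP[_ /set_mem/=]; rewrite mem_index_iota ltnS => /andP[_ jm].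
  have Ej := E_le Em jm.
  by rewrite lee_fin mulr_ge0 ?psum_ge0// ltW ?nu_gt0.
rewrite lee_fin; have [im|im] := leqP i m; first exact: H.
by rewrite /tail big_geq.
Qed.

Lemma opII_inv_fin f m i : E N m -> (forall j, (j <= m)%N -> 0 < f j) ->
  (forall j, E N j -> (m < j)%N -> f j = 0) -> (i <= m)%N ->
  ((opII a b N f i)^-1 = (f i / tail f m i)%:E)%E.
Proof.
move=> Em f0 fm im; have t0 := tail_gt0 Em f0 im.
rewrite -inve_opI_fin// /opII; congr (((_ * _)^-1)%E).
have -> : supp N f `&` [set j | (i <= j)%N] = [set` index_iota i m.+1].
  apply/seteqP; split=> j /=; rewrite mem_index_iota ltnS.
    move=> [[Ej fj] ->]/=; rewrite leqNgt; apply/negP => mj.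
    by rewrite fm ?eqxx in fj.
  move=> /andP[ij jm]; split=> //; split; first exact: E_le Em jm.
  by rewrite gt_eqF// f0.
rewrite esum_fset; last 2 first.
- exact: finite_seq.
- move=> j; rewrite inE/= mem_index_iota ltnS => /andP[_ jm].
  have Ej := E_le Em jm.
  rewrite lee_fin mulr_ge0 ?ltW ?nu_gt0 ?psum_gt0// => k kj.
  by apply: f0; exact: leq_trans kj jm.
by rewrite -fsbig_seq ?iota_uniq// sumEFin.
Qed.

(** Nonvanishing of the earlier entries is essential: at zero the extended inverse is [+oo], whereas
    the real inverse used by [drift] is 0. *)
Lemma opR_drift v i : E N i ->
  (forall j, ltN j N -> (j < i)%N -> extV N v j != 0) ->
  opR a b N v i = (drift (extV N v) i)%:E.
Proof.
case: i => [|i] Ei v0; rewrite /opR /drift /=.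
  by rewrite a0 mul0r add0r mul0e add0e.
by rewrite inver (negbTE (v0 i (E_ltN Ei) (ltnSn i))).
Qed.

Lemma opR_Ny v i : E N i.+1 -> extV N v i = 0 -> opR a b N v i.+1 = -oo%E.
Proof.
by move=> Ei vi; rewrite /opR /= vi inve0 /= gt0_muleNy ?lte_fin ?a_gt0.
Qed.

Lemma extV_E v i : ltN i N -> extV N v i = v i.
Proof. by rewrite /extV => ->. Qed.

(** The convention [v_N = 0] amounts to replacing [g] by [extE N g]. As [g i.+1 >= 0], this can only
    raise the flux at [i], while the incoming flux is unchanged. *)
Lemma drift_extV_ge g v c i : E N i -> (forall j, E N j -> 0 < g j) ->
  (forall j, ltN j N -> v j = ratio g j) -> 0 <= g i.+1 ->
  c * mu i * g i <= flux g i - (if i is j.+1 then flux g j else 0) ->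
  c <= drift (extV N v) i.
Proof.
move=> Ei g0 vg gS H.
have mg : 0 < mu i * g i by rewrite mulr_gt0 ?mu_gt0 ?g0.
have vE j : E N j -> extV N v j = ratio (extE N g) j.
  move=> Ej; rewrite /ratio (extE_E _ Ej) /extV /extE.
  have -> : leN j.+1 N = ltN j N by case: N.
  by case: ifP => jN; [rewrite vg|rewrite mul0r].
have -> : drift (extV N v) i = drift (ratio (extE N g)) i.
  rewrite /drift vE//; case: i {H gS mg} Ei => // i Ei.
  by rewrite vE//; exact: E_le Ei _.
rewrite -(ler_pM2r mg) [leRHS]mulrC -[in leRHS](extE_E g Ei) drift_ratio//.
  rewrite mulrA (le_trans H)// lerB//; first exact: flux_extE_ge.
  case: i {H gS mg} Ei => // i Ei.
  by rewrite /flux !extE_E//; exact: E_le Ei _.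
by move=> j ji; rewrite extE_E ?g0//; exact: E_le Ei ji.
Qed.

Lemma decr_E f : (forall k, E N k.+1 -> f k.+1 < f k) ->
  forall i j, E N j -> (i < j)%N -> f j < f i.
Proof.
move=> H i; elim=> [//|j ih] Ej; rewrite ltnS leq_eqVlt => /predU1P[->|ij].
  exact: H.
by apply: lt_trans (H _ Ej) (ih _ ij); exact: E_le Ej _.
Qed.

Lemma eig_decr l n : 0 < l -> E N n -> (forall i, (i <= n)%N -> 0 < eig l i) ->
  eig l n.+1 < eig l n.
Proof.
move=> l0 En pos; rewrite eigS gtrBl.
by rewrite !mulr_gt0// ?nu_gt0// psum_gt0.
Qed.

(** * The supremum formulas: upper bounds and optimal test functions *)

Section Bounds.
Variable l : R.
Hypotheses (l_ge0 : 0 <= l) (l_lb : rayleigh_lb l)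
  (l_max : forall c, rayleigh_lb c -> c <= l).

Lemma V1_le v c : V1 a b N v ->
  (forall i, E N i -> (c%:E <= opR a b N v i)%E) -> c <= l.
Proof.
move=> [Hfin Hinf] Hc; have v0 i : ltN i N -> 0 < v i.
  move=> iN; have : (\esum_(j in E N) (nu j)%:E <= +oo)%E by rewrite leey.
  rewrite le_eqVlt => /predU1P[/Hinf/(_ i iN)|/Hfin/(_ i iN)].
    by case/andP.
  by case/andP.
have v0' i : ltN i N -> 0 < extV N v i by move=> iN; rewrite extV_E// v0.
have ve0 i : 0 <= extV N v i.
  by rewrite /extV; case: ifP => // iN; rewrite ltW// v0.
apply: l_max => m h Em hm; apply: (@rayleigh_of_drift (extV N v)) => // i im.
  by apply/v0'/E_ltN; exact: E_le Em _.
have Ei := E_le Em im.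
rewrite -lee_fin -opR_drift ?Hc// => j jN _.
by rewrite gt_eqF// v0'.
Qed.

Lemma FI_le f c : FI N f ->
  (forall i, E N i -> (c%:E <= (opI a b N f i)^-1)%E) -> c <= l.
Proof.
move=> [f0 fdec] Hc; apply/l_max/(@rayleigh_of_tail f) => // m i Em im.
have f0' j : (j <= m)%N -> 0 < f j by move=> jm; apply/f0; exact: E_le Em _.
apply: (@le_trans _ _ (extE N f i - extE N f m.+1)).
  apply: tail_le_of_flux => // j jm; have Ej := E_le Em jm.
  have pj : 0 < psum f j by apply: psum_gt0 => // k kj; apply/f0'/(leq_trans kj).
  by have := Hc j Ej; rewrite opI_inv// lee_fin ler_pdivlMr.
rewrite extE_E ?gerBl; last exact: E_le Em im.
by rewrite /extE; case: ifP => // Em'; rewrite ltW// f0.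
Qed.

Lemma opII_gt0 f i : (forall i, E N i -> 0 < f i) -> E N i ->
  (0 < \esum_(j in supp N f `&` [set j | (i <= j)%N]) (nu j * psum f j)%:E)%E.
Proof.
move=> f0 Ei; have f0' j : (j <= i)%N -> 0 < f j.
  by move=> ji; apply: f0; exact: E_le Ei _.
apply: (@lt_le_trans _ _ (tail f i i)%:E); first by rewrite lte_fin tail_gt0.
by apply: esum_tail_ge => // j ji; rewrite gt_eqF// f0'.
Qed.

Lemma FII_le f c : FII N f ->
  (forall i, E N i -> (c%:E <= (opII a b N f i)^-1)%E) -> c <= l.
Proof.
move=> f0 Hc; apply/l_max/(@rayleigh_of_tail f) => // m i Em im.
have f0' j : (j <= m)%N -> 0 < f j by move=> jm; apply/f0; exact: E_le Em _.
have Ei := E_le Em im; have ti := tail_gt0 Em f0' im.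
(* The infinite double sum may be [+oo], with inverse 0. This is compatible with the hypothesis only
   for [c <= 0], where the claim is trivial. *)
have [c0|c0] := leP c 0.
  by rewrite (le_trans _ (ltW (f0' i im)))// mulr_le0_ge0// ltW.
have := Hc i Ei; rewrite /opII inve_opII_gt0 ?f0//; last exact: opII_gt0.
have := @esum_tail_ge f m i Em (fun j jm => lt0r_neq0 (f0' j jm)).
rewrite -/(psum f); case: (\esum_(_ in _) _)%R => [T||]//.
  rewrite lee_fin => tT; have T0 := lt_le_trans ti tT.
  rewrite inver gt_eqF// -EFinM lee_fin ler_pdivlMr// => cT.
  by rewrite (le_trans _ cT)// ler_pM2l.
by move=> _; rewrite invey mule0 lee_fin leNgt c0.
Qed.

(** For [l > 0] the ratios of [eig l] are optimal and lie in [(0,1)]. For [l = 0] a nonnegative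
    [opR] is enough, and the choice depends on whether the series of [nu] converges. *)
Lemma V1_attained : exists2 v, V1 a b N v &
  forall i, E N i -> (l%:E <= opR a b N v i)%E.
Proof.
have [l0|] := ltP 0 l.
  have pos i : E N i -> 0 < eig l i by exact: eig_gt0.
  have v01 i : ltN i N -> 0 < ratio (eig l) i < 1.
    move=> /ltN_E Ei; have Ei' := E_le Ei (leqnSn i).
    rewrite divr_gt0 ?pos//= ltr_pdivrMr ?pos// mul1r eig_decr// => j ji.
    by apply: pos; exact: E_le Ei' ji.
  exists (ratio (eig l)).
    by split=> _ i /v01// /andP[-> /ltW].
  move=> i Ei; rewrite opR_drift// => [|j jN _]; last first.
    by rewrite extV_E// gt_eqF//; have /andP[] := v01 j jN.
  rewrite lee_fin; apply: (@drift_extV_ge (eig l)) => //.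
    exact: eig_next_ge0.
  case: i Ei => [|i] Ei; rewrite !flux_eig ?psum0 ?mu0//.
  - by rewrite le_eqVlt; apply/orP; left; apply/eqP; ring.
  - by rewrite psumS le_eqVlt; apply/orP; left; apply/eqP; ring.
  - exact: E_le Ei _.
move=> l0; have {l0} -> : l = 0 by apply/eqP; rewrite eq_le l0 l_ge0.
have [Hoo|Hfin] := eqVneq (\esum_(j in E N) (nu j)%:E)%R +oo%E.
  exists (fun=> 1); first by split=> [|_ i _]; [rewrite Hoo|rewrite ltr01 lexx].
  move=> i Ei; rewrite opR_drift// => [|j jN _]; last by rewrite extV_E// oner_neq0.
  rewrite lee_fin /drift addr_ge0//.
    case: i Ei => [|i] Ei; first by rewrite a0 mul0r.
    by rewrite extV_E ?invr1 ?subrr ?mulr0//; exact: E_ltN.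
  apply: mulr_ge0; first by rewrite ltW ?b_gt0.
  by rewrite subr_ge0 /extV; case: ifP.
have sge m : E N m -> ((\sum_(i < m.+1) nu i)%:E <= \esum_(j in E N) (nu j)%:E)%E.
  move=> Em; apply: esum_ge; exists `I_m.+1.
    by split; [exact: finite_II|move=> j /= jm; exact: E_le Em _].
  by rewrite -sumEFin (@fsbig_ord _ _ _ m.+1 (fun i => (nu i)%:E)).
case: (\esum_(j in E N) (nu j)%:E)%R Hfin sge => [A||]//; last first.
  move=> _ /(_ 0%N); rewrite leeNy_eq => H.
  by have /H : E N 0 by rewrite /E /=; case: N.
move=> _ sge.
(* The remainder of the convergent series: its flux is constantly 1, so it is harmonic away from 0,
   and it is strictly decreasing, which keeps the ratios below 1. *)
pose g i := A - \sum_(j < i) nu j.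
have gnu i : E N i -> 0 <= g i.+1.
  by move=> Ei; rewrite /g subr_ge0 -lee_fin; exact: sge.
have gS i : g i.+1 = g i - nu i by rewrite /g big_ord_recr /=; ring.
have g0 i : E N i -> 0 < g i.
  move=> Ei; have := gnu i Ei; rewrite gS subr_ge0; apply: lt_le_trans.
  exact: nu_gt0.
have v01 i : ltN i N -> 0 < ratio g i < 1.
  move=> /ltN_E Ei; have Ei' := E_le Ei (leqnSn i).
  by rewrite divr_gt0 ?g0//= ltr_pdivrMr ?g0// mul1r gS gtrBl nu_gt0.
have fg i : E N i -> flux g i = 1.
  move=> Ei; rewrite /flux gS opprB addrC subrK mulfV// lt0r_neq0//.
  exact: mub_gt0.
exists (ratio g); first by split=> _ i /v01// /andP[-> /ltW].
move=> i Ei; rewrite opR_drift// => [|j jN _]; last first.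
  by rewrite extV_E// gt_eqF//; have /andP[] := v01 j jN.
rewrite lee_fin; apply: (@drift_extV_ge g) => //; first exact: gnu.
rewrite !mul0r fg//; case: i Ei => [|i] Ei; first by rewrite subr0 ler01.
by rewrite fg ?subrr//; exact: E_le Ei _.
Qed.

Lemma FI_attained : exists2 f, FI N f &
  forall i, E N i -> (l%:E <= (opI a b N f i)^-1)%E.
Proof.
have [l0|] := ltP 0 l.
  have pos i : E N i -> 0 < eig l i by exact: eig_gt0.
  exists (eig l).
    split=> //; apply: decr_E => k Ek; apply: eig_decr => // [|i ik].
      exact: E_le Ek _.
    by apply: pos; apply: E_le Ek _; exact: leqW.
  move=> i Ei; have p : 0 < psum (eig l) i.
    by apply: psum_gt0 => // j ji; apply: pos; exact: E_le Ei ji.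
  rewrite opI_inv// lee_fin ler_pdivlMr// -flux_eig//.
  by apply: flux_extE_ge => //; exact: eig_next_ge0.
move=> l0; have {l0} -> : l = 0 by apply/eqP; rewrite eq_le l0 l_ge0.
(* For [l = 0] any positive strictly decreasing function has nonnegative flux. *)
pose f i : R := i.+1%:R^-1.
have f0 i : 0 < f i by rewrite invr_gt0 ltr0n.
have fS i : f i.+1 <= f i by rewrite lef_pV2 ?posrE ?ltr0n// ler_nat.
exists f.
  split=> // i j _ ij; rewrite /f ltf_pV2 ?posrE ?ltr0n// ltr_nat; lia.
move=> i Ei; have p : 0 < psum f i by exact: psum_gt0.
rewrite opI_inv// lee_fin divr_ge0//; last exact: ltW.
apply: le_trans (flux_extE_ge _ _) => //.
  by rewrite mulr_ge0 ?subr_ge0// ltW ?mub_gt0.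
exact: ltW.
Qed.

Lemma FII_attained : exists2 f, FII N f &
  forall i, E N i -> (l%:E <= (opII a b N f i)^-1)%E.
Proof.
have [l0|] := ltP 0 l.
  have pos i : E N i -> 0 < eig l i by exact: eig_gt0.
  exists (eig l) => // i Ei; rewrite /opII.
  have := opII_gt0 pos Ei; rewrite -/(psum (eig l)).
  have : (\esum_(j in supp N (eig l) `&` [set j | (i <= j)%N])
           (nu j * psum (eig l) j)%:E <= (eig l i / l)%:E)%E.
    apply: esum_tail_le => [j Ej|m Em im|]; first by rewrite ltW ?pos.
      rewrite ler_pdivlMr// mulrC.
      apply: (le_trans (@tail_le_of_flux (eig l) (eig l) l m i Em im _)).
        by move=> j jm; rewrite flux_eig//; exact: E_le Em _.
      by rewrite gerBl eig_next_ge0.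
    by rewrite divr_ge0 ?ltW ?pos.
  case: (\esum_(_ in _) _)%R => [T||]//; rewrite lee_fin lte_fin => TE T0.
  by rewrite inve_opI_fin// lee_fin ler_pdivlMr// mulrC -ler_pdivlMr.
move=> l0; have {l0} -> : l = 0 by apply/eqP; rewrite eq_le l0 l_ge0.
exists (fun=> 1) => [i _ //|i Ei]; rewrite inve_ge0 mule_ge0 ?inve_ge0 ?lee_fin//.
exact/ltW/(@opII_gt0 (fun=> 1) i).
Qed.

(** * The infimum formulas: finitely supported tests bound [l] from above *)

Lemma V1_fin_ge v c : V1_fin a b N v ->
  (forall i, E N i -> (opR a b N v i <= c%:E)%E) -> l <= c.
Proof.
move=> [m [_ Em vb v0]] Hc.
have vpos i : (i < m)%N -> 0 < extV N v i.
  move=> im; have Ei : E N i.+1 by exact: E_le Em im.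
  rewrite extV_E ?E_ltN//; have /andP[+ _] := vb i im; apply: lt_trans.
  by rewrite divr_gt0 ?a_gt0// addr_gt0 ?a_gt0 ?b_gt0.
apply: (@drift_ge_of_rayleigh (extV N v) c l m) => // [|i im].
  by rewrite /extV; case: ifP => // mN; exact: v0.
have Ei := E_le Em im.
rewrite -lee_fin -opR_drift ?Hc// => j _ ji.
by rewrite gt_eqF// vpos//; exact: leq_trans ji im.
Qed.

Lemma FII_fin_ge f c : FII_fin N f ->
  (forall i, supp N f i -> ((opII a b N f i)^-1 <= c%:E)%E) -> l <= c.
Proof.
move=> [m [_ Em f0 fm]] Hc; apply: (rayleigh_le_tail l_lb Em f0) => i im.
have t0 := tail_gt0 Em f0 im; rewrite -ler_pdivrMr// -lee_fin.
rewrite -(opII_inv_fin Em)//; apply: Hc; split; first exact: E_le Em im.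
by rewrite gt_eqF// f0.
Qed.

Lemma FI_fin_pos f n m : (n < m)%N -> (forall i, (i <= n)%N -> f i = f n) ->
  (forall i j, (n <= i)%N -> (i < j)%N -> (j <= m)%N -> f j < f i) ->
  0 < f m -> forall i, (i <= m)%N -> 0 < f i.
Proof.
move=> nm fn fdec fm0 i im; have fn0 := lt_trans fm0 (fdec n m (leqnn n) nm (leqnn m)).
have [/fn->//|ni] := leqP i n; move: im; rewrite leq_eqVlt => /predU1P[->//|im].
exact: lt_trans fm0 (fdec i m (ltnW ni) im (leqnn m)).
Qed.

Lemma FI_fin_ge f c : FI_fin N f ->
  (forall i, E N i -> ((opI a b N f i)^-1 <= c%:E)%E) -> l <= c.
Proof.
move=> [n [m [[nm Em] fn fdec fm0 fm]]] Hc.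
have f0 := FI_fin_pos nm fn fdec fm0.
have fm1 : extE N f m.+1 = 0 by rewrite /extE; case: ifP => // Em'; exact: fm.
apply: (rayleigh_le_tail l_lb Em f0) => i im.
rewrite -(extE_E f (E_le Em im)) -[leLHS]subr0 -fm1.
apply: le_tail_of_flux => // j /andP[_ jm]; have Ej := E_le Em jm.
have pj : 0 < psum f j by apply: psum_gt0 => // k kj; apply/f0/(leq_trans kj).
by have := Hc j Ej; rewrite opI_inv// lee_fin ler_pdivrMr.
Qed.

(** * Nearly optimal finitely supported tests *)

Hypothesis E1 : E N 1.

Lemma lt_b0 : l < b 0.
Proof.
have := eig_gt0 l_lb l_ge0 E1; have b0 := b_gt0 (E_le E1 (leqnSn 0)).
by rewrite eigS eig0 psum0 eig0 mulr1 subr_gt0 /Defs.nu mu0 mul1r ltr_pdivrMr ?mul1r.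
Qed.

(** Since [eig c 1 = 1 - c / b 0 > 0], the escape index cannot be 0, as the finite test classes
    require. *)
Lemma eig_trunc c : l < c < b 0 -> exists m, [/\ (1 <= m)%N, E N m,
  forall i, (i <= m)%N -> 0 < eig c i & eig c m.+1 <= 0].
Proof.
move=> /andP[lc cb]; have [m [Em pos neg]] := eig_escape l_max lc.
exists m; split=> //; case: m {Em pos} neg => //.
have b0 := b_gt0 (E_le E1 (leqnSn 0)).
rewrite eigS eig0 psum0 eig0 mulr1 subr_le0 /Defs.nu mu0 mul1r.
by rewrite ler_pdivlMr// mul1r leNgt cb.
Qed.

Lemma eig_le_tail c m i : E N m -> eig c m.+1 <= 0 -> (i <= m)%N ->
  eig c i <= c * tail (eig c) m i.
Proof.
move=> Em neg im; apply: (@le_trans _ _ (eig c i - eig c m.+1)).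
  by rewrite lerDl oppr_ge0.
by apply: le_tail_of_flux => // j /andP[_ jm]; rewrite flux_eig//; exact: E_le Em _.
Qed.

Lemma FII_fin_approx c : l < c < b 0 -> exists2 f, FII_fin N f &
  forall i, supp N f i -> ((opII a b N f i)^-1 <= c%:E)%E.
Proof.
move=> /eig_trunc[m [m1 Em pos neg]].
pose f i := if (i <= m)%N then eig c i else 0.
have fE i : (i <= m)%N -> f i = eig c i by rewrite /f => ->.
have f0 i : (i <= m)%N -> 0 < f i by move=> im; rewrite fE// pos.
have fm i : E N i -> (m < i)%N -> f i = 0 by rewrite /f ltnNge => _ /negbTE->.
exists f; first by exists m.
move=> i [Ei fi]; have im : (i <= m)%N.
  by rewrite leqNgt; apply: contra fi => mi; rewrite fm.
have t0 := tail_gt0 Em f0 im.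
rewrite (opII_inv_fin Em)// lee_fin ler_pdivrMr// (@eq_tail f (eig c))// fE//.
exact: eig_le_tail.
Qed.

Lemma FI_fin_approx c : l < c < b 0 -> exists2 f, FI_fin N f &
  forall i, E N i -> ((opI a b N f i)^-1 <= c%:E)%E.
Proof.
move=> lcb; have c0 : 0 < c by have /andP[/(le_lt_trans l_ge0)] := lcb.
have [m [m1 Em pos neg]] := eig_trunc lcb.
pose f i := if (i <= m)%N then eig c i else 0.
have fE i : (i <= m)%N -> f i = eig c i by rewrite /f => ->.
have fm i : (m < i)%N -> f i = 0 by rewrite /f ltnNge => /negbTE->.
have dec k : (k < m)%N -> eig c k.+1 < eig c k.
  move=> km; apply: eig_decr => // [|i ik]; first exact: E_le Em (ltnW km).
  by apply: pos; exact: leq_trans ik (ltnW km).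
exists f.
  exists 0%N, m; split=> //.
  - by move=> i; rewrite leqn0 => /eqP->.
  - move=> i j _ ij jm; rewrite !fE//; last exact: leq_trans (ltnW ij) jm.
    elim: j ij jm => [//|j ih]; rewrite ltnS leq_eqVlt => /predU1P[->|ij] jm.
      exact: dec.
    by apply: lt_trans (dec _ jm) (ih ij _); exact: ltnW.
  - by rewrite fE ?pos.
  - by move=> i _; exact: fm.
move=> i Ei; have psE j : (j <= m)%N -> psum f j = psum (eig c) j.
  by move=> jm; apply: eq_bigr => k _; rewrite fE//; have := ltn_ord k; lia.
have p : 0 < psum f i.
  rewrite /psum big_ord_recl ltr_pwDl//; first by rewrite mu0 mul1r fE ?eig0.
  apply: sumr_ge0 => k _.
  have Ek : E N (lift ord0 k) by apply: E_le Ei _; rewrite lift0.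
  rewrite mulr_ge0//; first exact/ltW/mu_gt0.
  by rewrite /f; case: ifP => // km; rewrite ltW ?pos.
rewrite opI_inv// lee_fin ler_pdivrMr//.
have [im|im] := ltnP m i.
  have -> : flux (extE N f) i = 0; last by rewrite mulr_ge0 ?ltW.
  rewrite /flux extE_E// fm// /extE; case: ifP => _; last by ring.
  by rewrite fm ?leqW//; ring.
rewrite psE// -flux_eig// /flux ler_pM2l ?mub_gt0// extE_E// fE// lerD2l lerN2.
(* At [i = m] the cut replaces the nonpositive [eig c m.+1] by 0, which lowers the flux. *)
move: im; rewrite leq_eqVlt => /predU1P[->|im].
  by rewrite /extE fm// if_same.
by rewrite extE_E ?fE//; exact: E_le Em im.
Qed.

(** The ratios are those of [tail (eig c) m], which vanishes at [m + 1]. Up to [m] their drift is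
    [eig c i / g i], positive and at most [c]; positivity yields the two-sided constraint of
    [V1_fin]. *)
Lemma V1_fin_approx c : l < c < b 0 -> exists2 v, V1_fin a b N v &
  forall i, E N i -> (opR a b N v i <= c%:E)%E.
Proof.
move=> /eig_trunc[m [m1 Em pos neg]].
pose g := tail (eig c) m.
have g0 i : (i <= m)%N -> 0 < g i by exact: tail_gt0.
pose v i := if (i < m)%N then ratio g i else 0.
have vE i : (i <= m)%N -> extV N v i = ratio g i.
  rewrite leq_eqVlt => /predU1P[->|im].
    by rewrite /extV /v ltnn if_same /ratio /g tail_end mul0r.
  by rewrite extV_E /v ?im//; apply: E_ltN; exact: E_le Em im.
have v0 i : (m <= i)%N -> extV N v i = 0.
  by move=> im; rewrite /extV /v ltnNge im if_same.
have vpos i : (i < m)%N -> 0 < extV N v i.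
  by move=> im; rewrite (vE _ (ltnW im)); apply: divr_gt0; apply: g0 => //; exact: ltnW.
have vge0 i : 0 <= extV N v i.
  by have [im|im] := ltnP i m; [rewrite ltW ?vpos|rewrite v0].
have dE i : (i <= m)%N -> drift (extV N v) i = eig c i / g i.
  move=> im; rewrite -(drift_tail Em)// /drift vE//.
  by case: i im => // i im; rewrite (vE _ (ltnW im)).
exists v.
  exists m; split=> // [i im|i _]; last by rewrite /v ltnNge => ->.
  have Ei : E N i.+1 by exact: E_le Em im.
  have ai := a_gt0 Ei; have bi := b_gt0 Ei; have bi' := b_gt0 (E_le Ei (leqnSn i)).
  have vi := vpos i im; rewrite -(extV_E v (E_ltN Ei)).
  have d0 j : (j <= m)%N -> 0 < drift (extV N v) j.
    by move=> jm; rewrite dE// divr_gt0 ?pos ?g0.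
  apply/andP; split.
    (* The lower constraint comes from positive drift at [i + 1], multiplied by [v_i], and
       [v_(i+1) >= 0]; the upper one is positive drift at [i]. *)
    rewrite ltr_pdivrMr; last exact: addr_gt0.
    have := d0 i.+1 im; rewrite /drift => d.
    have : 0 < extV N v i *
      (a i.+1 * (1 - (extV N v i)^-1) + b i.+1 * (1 - extV N v i.+1)).
      by rewrite mulr_gt0.
    rewrite mulrDr mulrCA mulrBr mulr1 mulfV ?gt_eqF// => {}d.
    have := mulr_ge0 (mulr_ge0 (ltW vi) (ltW bi)) (vge0 i.+1); lra.
  have := d0 i (ltnW im); rewrite /drift -/(shiftV N v i) => d.
  rewrite ltrBrDl -ltrBrDr ltr_pdivrMr//; lra.
move=> i Ei; have [im|im] := leqP i m.
  rewrite opR_drift// => [|j _ ji].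
    by rewrite dE// lee_fin ler_pdivrMr ?g0// eig_le_tail.
  by rewrite gt_eqF// vpos//; exact: leq_trans ji im.
by case: i Ei im => // i Ei im; rewrite opR_Ny ?leNye// v0.
Qed.

End Bounds.
End BirthDeath.

(** * Extended-real extrema and assembly of the formulas *)

Lemma ereal_sup_attained (R : realType) (T : Type) (A : set T)
    (F : T -> \bar R) (x : \bar R) :
  (forall t, A t -> F t <= x) -> (exists2 t, A t & x <= F t) ->
  x = ereal_sup [set F t | t in A] /\ attained A F.
Proof.
move=> ub [t At xt]; have e : x = ereal_sup [set F t | t in A].
  apply/eqP; rewrite eq_le; apply/andP; split.
    by apply: (le_trans xt); apply: ereal_sup_ubound; exists t.
  by apply: ge_ereal_sup => _ [s As <-]; exact: ub.
by split=> //; exists t => //; rewrite -e; apply/eqP; rewrite eq_le ub.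
Qed.

Lemma ereal_inf_approx (R : realType) (T : Type) (A : set T)
    (F : T -> \bar R) (x y : R) : (x < y)%R ->
  (forall t, A t -> x%:E <= F t) ->
  (forall c : R, (x < c < y)%R -> exists2 t, A t & F t <= c%:E) ->
  ereal_inf [set F t | t in A] = x%:E.
Proof.
move=> xy lb approx; apply/eqP; rewrite eq_le; apply/andP; split; last first.
  by apply: le_ereal_inf_tmp => _ [t At <-]; exact: lb.
apply/lee_addgt0Pr => e e0.
(* The minimum keeps the level inside [(x, y)], where tests are available, and below [x + e]. *)
have [|t At Ft] := approx (Num.min (x + e / 2) ((x + y) / 2))%R.
  by rewrite lt_min gt_min; apply/andP; split; [apply/andP; split|apply/orP; right]; lra.
apply: (@le_trans _ _ (F t)); first by apply: ereal_inf_lbound; exists t.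
rewrite (le_trans Ft)// -EFinD lee_fin ge_min; apply/orP; left; lra.
Qed.

Lemma ereal_inf_le_fin (R : realType) (S : set (\bar R)) (l : R) :
  (forall c : R, (forall x, S x -> c%:E <= x) -> (c <= l)%R) ->
  ereal_inf S <= l%:E.
Proof.
move=> H; have lb x : S x -> ereal_inf S <= x by exact: ereal_inf_lbound.
case: (ereal_inf S) lb => [c| |] lb; rewrite ?leNye ?lee_fin//; first exact: H.
suff : (l + 1 <= l)%R by rewrite gerDl ler10.
by apply: H => x /lb; apply: le_trans; rewrite leey.
Qed.

Lemma ereal_sup_ge_fin (R : realType) (S : set (\bar R)) (l : R) :
  (forall c : R, (forall x, S x -> x <= c%:E) -> (l <= c)%R) ->
  l%:E <= ereal_sup S.
Proof.
move=> H; have ub x : S x -> x <= ereal_sup S by exact: ereal_sup_ubound.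
case: (ereal_sup S) ub => [c| |] ub; rewrite ?leey ?lee_fin//; first exact: H.
suff : (l <= l - 1)%R by rewrite lerBrDr gerDl ler10.
by apply: H => x /ub /le_trans; apply; rewrite leNye.
Qed.

Theorem theorem2p4 (R : realType) (N : option nat) (a b : nat -> R)
    (hN : leN 1 N) (hab : rates a b N) :
  (* difference form *)
  [/\ ereal_inf [set ereal_sup [set opR a b N v i | i in E N]
                | v in V1_fin a b N] = lambda0 a b N,
      lambda0 a b N = ereal_sup [set ereal_inf [set opR a b N v i | i in E N]
                                | v in V1 a b N] &
      attained (V1 a b N)
        (fun v => ereal_inf [set opR a b N v i | i in E N])] /\
  (* single summation form *)
  [/\ ereal_inf [set ereal_sup [set (opI a b N f i)^-1 | i in E N]
                | f in FI_fin N] = lambda0 a b N,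
      lambda0 a b N = ereal_sup [set ereal_inf [set (opI a b N f i)^-1 | i in E N]
                                | f in FI N] &
      attained (FI N)
        (fun f => ereal_inf [set (opI a b N f i)^-1 | i in E N])] /\
  (* double summation form *)
  [/\ ereal_inf [set ereal_sup [set (opII a b N f i)^-1 | i in supp N f]
                | f in FII_fin N] = lambda0 a b N,
      lambda0 a b N = ereal_sup [set ereal_inf [set (opII a b N f i)^-1 | i in E N]
                                | f in FII N] &
      attained (FII N)
        (fun f => ereal_inf [set (opII a b N f i)^-1 | i in E N])].
Proof.
have [l [-> l_ge0 l_lb l_max]] := lambda0P hab.
have lb := lt_b0 hab l_ge0 l_lb hN.
(* The index set [I] depends on the test function because the double summation form ranges over its
   support. *)
have upper (A : set (nat -> R)) (I : (nat -> R) -> set nat)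
    (F : (nat -> R) -> nat -> \bar R) :
  (forall f (c : R), A f -> (forall i, I f i -> F f i <= c%:E) -> (l <= c)%R) ->
  (forall c : R, (l < c < b 0)%R ->
     exists2 f, A f & forall i, I f i -> F f i <= c%:E) ->
  ereal_inf [set ereal_sup [set F f i | i in I f] | f in A] = l%:E.
  move=> Hge Happ; apply: (ereal_inf_approx lb) => [f Af|c lcb].
    apply: ereal_sup_ge_fin => c Hc; apply: (Hge f) => // i Ii.
    by apply: Hc; exists i.
  have [f Af Hf] := Happ c lcb; exists f => //.
  by apply: ge_ereal_sup => _ [i Ii <-]; exact: Hf.
have lower (A : set (nat -> R)) (F : (nat -> R) -> nat -> \bar R) :
  (forall f (c : R), A f -> (forall i, E N i -> c%:E <= F f i) -> (c <= l)%R) ->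
  (exists2 f, A f & forall i, E N i -> l%:E <= F f i) ->
  l%:E = ereal_sup [set ereal_inf [set F f i | i in E N] | f in A] /\
  attained A (fun f => ereal_inf [set F f i | i in E N]).
  move=> Hle [f Af Hf]; apply: ereal_sup_attained => [g Ag|].
    apply: ereal_inf_le_fin => c Hc; apply: (Hle g) => // i Ei.
    by apply: Hc; exists i.
  exists f => //; apply: le_ereal_inf_tmp => _ [i Ei <-]; exact: Hf.
have [R_sup R_att] :=
  lower _ _ (fun v c => @V1_le _ _ _ _ hab _ l_max v c)
    (V1_attained hab l_ge0 l_lb).
have [I_sup I_att] :=
  lower _ (fun f i => (opI a b N f i)^-1)
    (fun f c => @FI_le _ _ _ _ hab _ l_max f c)
    (FI_attained hab l_ge0 l_lb).
have [II_sup II_att] :=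
  lower _ (fun f i => (opII a b N f i)^-1)
    (fun f c => @FII_le _ _ _ _ hab _ l_max f c)
    (FII_attained hab l_ge0 l_lb).
split; last split; split=> //.
- exact: (upper _ (fun=> E N) _ (fun v c => @V1_fin_ge _ _ _ _ hab _ l_lb v c)
    (V1_fin_approx hab l_max hN)).
- exact: (upper _ (fun=> E N) (fun f i => (opI a b N f i)^-1)
    (fun f c => @FI_fin_ge _ _ _ _ hab _ l_lb f c)
    (FI_fin_approx hab l_ge0 l_max hN)).
- exact: (upper _ (supp N) (fun f i => (opII a b N f i)^-1)
    (fun f c => @FII_fin_ge _ _ _ _ hab _ l_lb f c)
    (FII_fin_approx hab l_max hN)).
Qed.
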